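(* As formal power series in $x,q$, \[ \sum_{m,n\geq0}\frac{x^{m+2n}q^{\frac{3m^2-m}{2}+4mn+4n^2}}{(q;q)_m(q^4;q^4)_n}=\sum_{m,n\geq0}\frac{x^{m+2n}q^{\frac{3m^2-m}{2}+4mn+4n^2+m}(1+xq^{2m+4n+1})}{(q;q)_m(q^4;q^4)_n}, \] \[ \sum_{m,n\geq0}\frac{x^{m+2n}q^{\frac{3m^2-m}{2}+4mn+4n^2+2m+4n}}{(q;q)_m(q^4;q^4)_n}=\sum_{m,n\geq0}\frac{x^{m+2n}q^{\frac{3m^2-m}{2}+4mn+4n^2+3m+4n}(1+xq^{2m+4n+3})}{(q;q)_m(q^4;q^4)_n}. \]
   Context: $(a;q)_k=\prod_{i=0}^{k-1}(1-aq^i)$. *)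

(* Defs.v *)
From HB Require Import structures.
From mathcomp Require Import all_boot all_order all_algebra.
From mathcomp Require Import boolp classical_sets cardinality fsbigop.

Set Implicit Arguments.
Unset Strict Implicit.
Unset Printing Implicit Defensive.

Import GRing.Theory.
Local Open Scope ring_scope.

(* [fps R] is R[[X]]. The record wrapper keeps the Cauchy product apart from
   the pointwise product that is canonical on [nat -> R]. *)
Record fps (R : Type) := Fps { fps_coef : nat -> R }.

Arguments Fps {R} fps_coef.

HB.instance Definition _ (R : Type) := [isNew for @fps_coef R].
HB.instance Definition _ (R : choiceType) := [Choice of fps R by <:].

Notation "p .@[ i ]" := (fps_coef p i)
  (at level 2, left associativity, format "p .@[ i ]") : ring_scope.

Lemma fpsP (R : Type) (f g : fps R) :
  (forall i, fps_coef f i = fps_coef g i) <-> f = g.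
Proof.
split=> [|-> //]; case: f g => [f] [g] /= fg.
by congr Fps; apply/funext.
Qed.

Section Zmod.
Variable R : zmodType.
Implicit Types f g h : fps R.

Definition fps_zero : fps R := Fps (fun=> 0).
Definition fps_opp f : fps R := Fps (fun i => - f.@[i]).
Definition fps_add f g : fps R := Fps (fun i => f.@[i] + g.@[i]).

Fact fps_addA : associative fps_add.
Proof. by move=> f g h; apply/fpsP => i /=; rewrite addrA. Qed.
Fact fps_addC : commutative fps_add.
Proof. by move=> f g; apply/fpsP => i /=; rewrite addrC. Qed.
Fact fps_add0 : left_id fps_zero fps_add.
Proof. by move=> f; apply/fpsP => i /=; rewrite add0r. Qed.
Fact fps_addN : left_inverse fps_zero fps_opp fps_add.
Proof. by move=> f; apply/fpsP => i /=; rewrite addNr. Qed.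

HB.instance Definition _ :=
  GRing.isZmodule.Build (fps R) fps_addA fps_addC fps_add0 fps_addN.

Lemma fps_coef0 i : (0 : fps R).@[i] = 0. Proof. by []. Qed.
Lemma fps_coefN f i : (- f).@[i] = - f.@[i]. Proof. by []. Qed.
Lemma fps_coefD f g i : (f + g).@[i] = f.@[i] + g.@[i]. Proof. by []. Qed.
Lemma fps_coefB f g i : (f - g).@[i] = f.@[i] - g.@[i]. Proof. by []. Qed.

Lemma fps_coef_sum (I : Type) (r : seq I) (P : pred I) (F : I -> fps R) i :
  (\sum_(k <- r | P k) F k).@[i] = \sum_(k <- r | P k) (F k).@[i].
Proof. exact: (big_morph (fun f => f.@[i]) (fun f g => fps_coefD f g i)). Qed.
End Zmod.

Section Ring.
Variable R : comNzRingType.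
Implicit Types f g h : fps R.

Definition fpsC (c : R) : fps R := Fps (fun i => if i == 0%N then c else 0).
Definition fpsX : fps R := Fps (fun i => (i == 1%N)%:R).
Definition fps_mul f g : fps R :=
  Fps (fun n => \sum_(i < n.+1) f.@[i] * g.@[n - i]).

Fact fps_mulC : commutative fps_mul.
Proof.
move=> f g; apply/fpsP => n /=; rewrite (reindex_inj rev_ord_inj) /=.
by apply: eq_bigr => i _; rewrite subSS subKn ?leq_ord // mulrC.
Qed.

Fact fps_mulA : associative fps_mul.
Proof.
move=> f g h; rewrite [in RHS]fps_mulC; apply/fpsP => n.
pose c j k := f.@[j] * (g.@[n - j - k] * h.@[k]).
transitivity (\sum_(j < n.+1) \sum_(k < n.+1 | (k <= n - j)%N) c j k).
  rewrite [fps_mul g h]fps_mulC; apply: eq_bigr => /= j _.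
  rewrite big_distrr /= (big_ord_narrow_leq (leq_subr _ _)) /=.
  by apply: eq_bigr => k _; rewrite /c [h.@[_] * _]mulrC.
rewrite (exchange_big_dep predT) //=; apply: eq_bigr => k _.
transitivity (\sum_(j < n.+1 | (j <= n - k)%N) c j k).
  apply: eq_bigl => j; rewrite -ltnS -(ltnS j) -!subSn ?leq_ord //.
  by rewrite -subn_gt0 -(subn_gt0 j) -!subnDA addnC.
rewrite (big_ord_narrow_leq (leq_subr _ _)) big_distrr /=.
by apply: eq_bigr => j _; rewrite /c -!subnDA addnC mulrA [RHS]mulrC.
Qed.

Fact fps_mul1 : left_id (fpsC 1) fps_mul.
Proof.
move=> f; apply/fpsP => n /=; rewrite big_ord_recl /= mul1r subn0.
by rewrite big1 ?addr0 // => i _; rewrite mul0r.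
Qed.

Fact fps_mulDl : left_distributive fps_mul +%R.
Proof.
move=> f g h; apply/fpsP => n /=; rewrite -big_split /=.
by apply: eq_bigr => i _; rewrite mulrDl.
Qed.

Fact fps_oner_neq0 : fpsC 1 != 0.
Proof.
by apply/eqP => /fpsP/(_ 0%N) /= /eqP; rewrite oner_eq0.
Qed.

HB.instance Definition _ := GRing.Zmodule_isComNzRing.Build (fps R)
  fps_mulA fps_mulC fps_mul1 fps_mulDl fps_oner_neq0.

Lemma fps_coef1 i : (1 : fps R).@[i] = (i == 0%N)%:R.
Proof. by rewrite /1%R /=; case: eqP. Qed.

Lemma fps_coefM f g n :
  (f * g).@[n] = \sum_(i < n.+1) f.@[i] * g.@[n - i].
Proof. by []. Qed.

Lemma fps_coefM0 f g : (f * g).@[0] = f.@[0] * g.@[0].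
Proof. by rewrite fps_coefM big_ord_recl big_ord0 addr0. Qed.

Lemma fps_coefCM c f n : (fpsC c * f).@[n] = c * f.@[n].
Proof.
rewrite fps_coefM big_ord_recl /= subn0 big1 ?addr0 // => i _.
by rewrite mul0r.
Qed.

Lemma fps_coefX_lt f k n :
  f.@[0] = 0 -> (n < k)%N -> (f ^+ k).@[n] = 0.
Proof.
move=> f0; elim: k n => [//|k IHk] n ltnk.
rewrite exprS fps_coefM big_ord_recl f0 mul0r add0r big1 // => i _ /=.
rewrite IHk ?mulr0 // /bump /= add1n.
case: n i ltnk => [[]//|n i ltnk]; rewrite subSS.
by rewrite (leq_ltn_trans (leq_subr _ _)).
Qed.
End Ring.

Section UnitRing.
Variable R : comUnitRingType.
Implicit Types f g : fps R.

Definition fps_unit : {pred fps R} := fun f => f.@[0] \is a GRing.unit.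

(* Geometric series: 1/f = c * \sum_k (1 - c * f)^k with c = 1/f(0); only the
   terms k <= n reach the coefficient of X^n. Non-units are mapped to
   themselves, the [invr_out] convention. *)
Definition fps_inv f : fps R :=
  if f.@[0] \is a GRing.unit then
    let c := f.@[0]^-1 in
    fpsC c * Fps (fun n => (\sum_(k < n.+1) (1 - fpsC c * f) ^+ k).@[n])
  else f.

Fact fps_mulVr : {in fps_unit, left_inverse 1 fps_inv *%R}.
Proof.
move=> f; rewrite unfold_in => Uf; rewrite /fps_inv Uf /=.
set c := _^-1; set u := 1 - _; set g := Fps _.
have u0 : u.@[0] = 0 by rewrite fps_coefB fps_coefCM mulVr // subrr.
rewrite mulrAC (_ : fpsC c * f = 1 - u); last by rewrite subKr.
apply/fpsP => n.
have gE i : (i <= n)%N -> g.@[i] = (\sum_(k < n.+1) u ^+ k).@[i].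
  move=> lein; rewrite /g /= !fps_coef_sum.
  rewrite (big_ord_widen n.+1 (fun k => (u ^+ k).@[i])) // big_mkcond /=.
  by apply: eq_bigr => k _; case: ltnP => // ltik; rewrite fps_coefX_lt.
transitivity (((1 - u) * \sum_(k < n.+1) u ^+ k).@[n]).
  by rewrite !fps_coefM; apply: eq_bigr => i _; rewrite gE ?leq_subr.
by rewrite -opprB mulNr -subrX1 opprB fps_coefB fps_coefX_lt ?subr0.
Qed.

Fact fps_unitPl f g : g * f = 1 -> fps_unit f.
Proof.
move=> /fpsP/(_ 0%N); rewrite fps_coefM0 fps_coef1 /= => gf1.
by apply/unitrPr; exists g.@[0]; rewrite mulrC.
Qed.

Fact fps_invr_out : {in [predC fps_unit], fps_inv =1 id}.
Proof. by move=> f; rewrite inE unfold_in /fps_inv => /negbTE ->. Qed.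

HB.instance Definition _ := GRing.ComNzRing_hasMulInverse.Build (fps R)
  fps_mulVr fps_unitPl fps_invr_out.
End UnitRing.

(* R[[x, q]] is represented as R[[q]][[x]], so [f.@[i].@[j]] is the
   coefficient of x^i q^j in f. *)
Notation fps2 R := (fps (fps R)).

Definition fps2x (R : comNzRingType) : fps2 R := @fpsX (fps R).
Definition fps2q (R : comNzRingType) : fps2 R := fpsC (fpsX R).

(* (a; q)_k *)
Definition qpoch (A : pzRingType) (a q : A) (k : nat) : A :=
  \prod_(i < k) (1 - a * q ^+ i).

(* A family of power series is summable when every coefficient receives only
   finitely many nonzero contributions. *)
Definition fps2_summable (R : zmodType) (F : nat -> nat -> fps2 R) : Prop :=
  forall i j : nat,
    finite_set [set p : nat * nat | (F p.1 p.2).@[i].@[j] <> 0]%classic.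

(* Meaningful for summable families only: \sum_(p \in _) is 0 by convention
   when infinitely many terms are nonzero. *)
Definition fps2_sum (R : zmodType) (F : nat -> nat -> fps2 R) : fps2 R :=
  Fps (fun i => Fps (fun j =>
    \sum_(p \in [set: nat * nat]%classic) (F p.1 p.2).@[i].@[j])).

(* Main.v *)
(* Multiplying the (m, n) term of the left side by 1 - q^m cancels the last factor of (q; q)_m,
   so it vanishes for m = 0 and for m = k + 1 it is the (k, n) term times
   x q^(3k+4n+1) for the first identity, x q^(3k+4n+3) for the second one.
   Hence the left side minus the first half of the right side is, after the
   shift m -> m + 1, the second half of the right side. *)
Require Import Defs.
From HB Require Import structures.
From mathcomp Require Import all_boot all_order all_algebra.
From mathcomp Require Import boolp classical_sets cardinality fsbigop ring zify.

Set Implicit Arguments.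
Unset Strict Implicit.
Unset Printing Implicit Defensive.

Import GRing.Theory.
Local Open Scope ring_scope.

Lemma fps_coefXnM_lt (R : comNzRingType) (g : fps R) (k i : nat) :
  (i < k)%N -> (fpsX R ^+ k * g).@[i] = 0.
Proof.
move=> ltik; rewrite fps_coefM big1 // => l _.
by rewrite fps_coefX_lt ?mul0r // (leq_ltn_trans _ ltik) // -ltnS.
Qed.

Lemma qpochSr (A : pzRingType) (a q : A) (k : nat) :
  qpoch a q k.+1 = qpoch a q k * (1 - a * q ^+ k).
Proof. by rewrite /qpoch big_ord_recr. Qed.

Lemma fps2_unitE (R : comUnitRingType) (f : fps2 R) :
  (f \is a GRing.unit) = (f.@[0].@[0] \is a GRing.unit).
Proof. by []. Qed.

Lemma fps2q_unit_subXn (R : comUnitRingType) (k : nat) :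
  1 - fps2q R ^+ k.+1 \is a GRing.unit.
Proof.
by rewrite fps2_unitE exprS !(fps_coefB, fps_coefM0, fps_coef1) mul0r subr0 unitr1.
Qed.

(** Every factor is 1 minus a positive power of q, so its constant coefficient is 1; the base
    [q ^+ r.+1] keeps that power positive. *)
Lemma qpoch_unit (R : comUnitRingType) (r k : nat) :
  qpoch (fps2q R ^+ r.+1) (fps2q R ^+ r.+1) k \is a GRing.unit.
Proof.
rewrite /qpoch; elim/big_ind: _ => [|f g Uf Ug|i _]; first exact: unitr1.
  by rewrite unitrM Uf.
by rewrite -exprS -exprM mulSn addSn fps2q_unit_subXn.
Qed.

(** Divisibility of each term by x^(m+n): the coefficient of x^i then only sees the finite box m, n
    <= i, whatever the power of q. *)
Definition x_dominated (R : zmodType) (F : nat -> nat -> fps2 R) : Prop :=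
  forall m n i : nat, (i < m + n)%N -> (F m n).@[i] = 0.

Lemma x_dominated_support (R : zmodType) (F : nat -> nat -> fps2 R)
    (i j : nat) (p : nat * nat) :
    x_dominated F ->
  p \notin [seq (m, n) | m <- iota 0 i.+1, n <- iota 0 i.+1] ->
  (F p.1 p.2).@[i].@[j] = 0.
Proof.
case: p => m n domF notin; rewrite (domF m n) // ltnNge.
apply: contra notin => le_mn; apply: allpairs_f; rewrite mem_iota; lia.
Qed.

Lemma x_dominated_summable (R : zmodType) (F : nat -> nat -> fps2 R) :
  x_dominated F -> fps2_summable F.
Proof.
move=> domF i j.
apply: sub_finite_set
  (finite_seq [seq (m, n) | m <- iota 0 i.+1, n <- iota 0 i.+1]) => p /= Fp.
by apply: contra_notT Fp; apply: x_dominated_support.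
Qed.

Lemma x_dominated_sumE (R : zmodType) (F : nat -> nat -> fps2 R) (i j : nat) :
    x_dominated F ->
  (fps2_sum F).@[i].@[j] =
    \sum_(0 <= m < i.+1) \sum_(0 <= n < i.+1) (F m n).@[i].@[j].
Proof.
move=> domF; rewrite /fps2_sum /=.
rewrite (fsbigE [seq (m, n) | m <- iota 0 i.+1, n <- iota 0 i.+1]) //.
- under eq_bigl do rewrite in_setT.
  by rewrite /index_iota subn0 big_allpairs.
- by rewrite allpairs_uniq ?iota_uniq // => -[? ?] [? ?].
- by move=> p _; apply: x_dominated_support.
Qed.

(** On the box m, n <= i, the columns m >= 1 of [A] use up [C] only for m < i; the leftover column m
    = i of [C] has no x^i term. *)
Lemma fps2_sum_shift (R : zmodType) (A B C : nat -> nat -> fps2 R) :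
    x_dominated A -> x_dominated B ->
    (forall n, A 0%N n = B 0%N n) ->
    (forall m n, A m.+1 n = B m.+1 n + C m n) ->
  fps2_sum A = fps2_sum (fun m n => B m n + C m n).
Proof.
move=> domA domB AB0 ABS.
(* As a difference of terms of index m + 1, [C m n] is divisible by x^(m+n+1), one power more than
   domination asks for. *)
have CE m n i : (i <= m + n)%N -> (C m n).@[i] = 0.
  move=> lei; have -> : C m n = A m.+1 n - B m.+1 n by rewrite ABS addrC addKr.
  by rewrite fps_coefB domA ?domB ?subrr ?addSn.
have domBC : x_dominated (fun m n => B m n + C m n).
  by move=> m n i lti; rewrite fps_coefD domB // CE ?addr0 // ltnW.
apply/fpsP => i; apply/fpsP => j; rewrite !x_dominated_sumE //.
rewrite [in RHS](eq_bigr (fun m => \sum_(0 <= n < i.+1) (B m n).@[i].@[j] +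
                        \sum_(0 <= n < i.+1) (C m n).@[i].@[j])); last first.
  by move=> m _; rewrite -big_split.
rewrite big_split /= [X in _ = _ + X]big_nat_recr //=.
rewrite [X in _ = _ + (_ + X)]big1 ?addr0; last first.
  by move=> n _; rewrite CE ?leq_addr.
rewrite big_nat_recl // [X in _ = X + _]big_nat_recl // -addrA -big_split /=.
congr (_ + _); first by apply: eq_bigr => n _; rewrite AB0.
apply: eq_bigr => m _; rewrite -big_split; apply: eq_bigr => n _.
by rewrite ABS.
Qed.

(** Common form of both identities: they differ only in the exponents of q, and the two exponent
    relations assumed here are what the shift m -> m + 1 requires. *)
Lemma fps2_qpoch_shift (R : comUnitRingType) (E E' c : nat -> nat -> nat)
    (D : nat -> fps2 R) :
    let x := fps2x R in
    let q := fps2q R in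
    let d m n := qpoch q q m * D n in
    let A m n := x ^+ (m + 2 * n) * q ^+ E m n / d m n in
    let B m n :=
      x ^+ (m + 2 * n) * q ^+ E' m n * (1 + x * q ^+ c m n) / d m n in
    (forall n, D n \is a GRing.unit) ->
    (forall m n, E' m n = E m n + m)%N ->
    (forall m n, E m.+1 n = E' m n + c m n)%N ->
  [/\ fps2_summable A, fps2_summable B & fps2_sum A = fps2_sum B].
Proof.
move=> x q d A B UD E'E ES.
have domA : x_dominated A.
  by move=> m n i lti; rewrite /A -mulrA fps_coefXnM_lt //; lia.
have domB : x_dominated B.
  by move=> m n i lti; rewrite /B -!mulrA fps_coefXnM_lt //; lia.
split; [exact: x_dominated_summable..|].
(* The two halves of [B] given by the factor 1 + x q^c; the second has the numerator of [A m.+1 n]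
   over the denominator [d m n]. *)
pose B1 m n := x ^+ (m + 2 * n) * q ^+ E' m n / d m n.
pose C m n := x ^+ (m.+1 + 2 * n) * q ^+ E m.+1 n / d m n.
have -> : B = fun m n => B1 m n + C m n.
  apply/funext => m; apply/funext => n.
  by rewrite /B /B1 /C ES addSn exprS [q ^+ (_ + _)]exprD; ring.
apply: fps2_sum_shift => //.
- by move=> m n i lti; rewrite /B1 -mulrA fps_coefXnM_lt //; lia.
- by move=> n; rewrite /A /B1 E'E addn0.
move=> m n; rewrite /A /B1 /C E'E [q ^+ (_ + _)]exprD.
have -> : d m.+1 n = d m n * (1 - q ^+ m.+1).
  by rewrite /d qpochSr -exprS mulrAC.
have Ud : d m n \is a GRing.unit.
  (* With r = 0 the base [q ^+ 1] is convertible to [q]. *)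
  by rewrite unitrM UD andbT; apply: (@qpoch_unit R 0).
have Uq := fps2q_unit_subXn R m; rewrite -/q in Uq.
(* Over the common denominator [d m.+1 n], the claim reduces to 1 = q^(m+1) + (1 - q^(m+1)). *)
have -> : (d m n)^-1 = (d m n * (1 - q ^+ m.+1))^-1 * (1 - q ^+ m.+1).
  by rewrite (invrM Ud Uq) mulrC mulVKr.
by move: (_^-1) => w; ring.
Qed.

Theorem theorem3p4 (R : comUnitRingType) :
  let x := fps2x R in
  let q := fps2q R in
  let e (m n : nat) := ((3 * m ^ 2 - m) %/ 2 + 4 * m * n + 4 * n ^ 2)%N in
  let d (m n : nat) := qpoch q q m * qpoch (q ^+ 4) (q ^+ 4) n in
  let L1 (m n : nat) := x ^+ (m + 2 * n) * q ^+ (e m n) / d m n in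
  let R1 (m n : nat) :=
    x ^+ (m + 2 * n) * q ^+ (e m n + m)
      * (1 + x * q ^+ (2 * m + 4 * n + 1)) / d m n in
  let L2 (m n : nat) :=
    x ^+ (m + 2 * n) * q ^+ (e m n + 2 * m + 4 * n) / d m n in
  let R2 (m n : nat) :=
    x ^+ (m + 2 * n) * q ^+ (e m n + 3 * m + 4 * n)
      * (1 + x * q ^+ (2 * m + 4 * n + 3)) / d m n in
  [/\ fps2_summable L1, fps2_summable R1 & fps2_sum L1 = fps2_sum R1] /\
  [/\ fps2_summable L2, fps2_summable R2 & fps2_sum L2 = fps2_sum R2].
Proof.
move=> x q e d L1 R1 L2 R2.
have eS m n : e m.+1 n = (e m n + 3 * m + 4 * n + 1)%N.
  (* The numerator grows by an even amount, so the floor division by 2 splits exactly. *)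
  rewrite /e (_ : 3 * m.+1 ^ 2 - m.+1 = (3 * m + 1) * 2 + (3 * m ^ 2 - m))%N.
    by rewrite divnMDl //; lia.
  by nia.
have UD n : qpoch (q ^+ 4) (q ^+ 4) n \is a GRing.unit by apply: qpoch_unit.
split; apply: fps2_qpoch_shift => // m n; rewrite ?eS; lia.
Qed.
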